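(* The Penalty Method is equivalent to the Active Set Method in the limit $\rho\downarrow 0$. That is, consider the scheme obtained from the Penalty Method by replacing $[\cdot]_\rho$ and $[\cdot]_\rho'$ by their limits for $\rho\downarrow0$, namely $[\cdot]_+$ and $\phi\mapsto\mathds{1}_{\phi>0}$ (both methods and these limits are specified in the context). Then for every $k\ge 0$, every iterate $u^k\in V$ and every $u^{k+1}\in V$, the element $u^{k+1}$ is a result of one step of this limit scheme from $u^k$ if and only if it is a result of one step of the Active Set Method from $u^k$, i.e. if and only if $$(\mathds{1}_{\mathcal I}^k A+\mathds{1}_{\mathcal A}^k c)\,u^{k+1}=\mathds{1}_{\mathcal I}^k f+\mathds{1}_{\mathcal A}^k c\,g .$$
   Context: Setting. $\Omega\subset\mathbb{R}^n$ is an open domain and $V$ is a function space on $\Omega$, assumed to be a reflexive Banach space with norm $\|\cdot\|$ and dual $V^*$; $\langle\cdot,\cdot\rangle$ is the $V^*\times V$ duality pairing. $f\in V^*$ is a bounded linear functional, $g\in V$ is given, and $A:V\to V^*$ is a linear, continuous, $V$-elliptic operator: there are constants $C,C'>0$ with $\langle Au,v\rangle\le C\|u\|\|v\|$ and $\langle Av,v\rangle\ge C'\|v\|^2$ for all $u,v\in V$. The map $c:V\to V^*$ is the (linear) inverse Riesz map, possibly scaled by a positive factor. These data belong to the constrained problem of minimizing $\frac12\langle Av,v\rangle-\langle f,v\rangle$ over $v\in V$ subject to $v\le g$. Nonlinear functions. $[\psi]_+=\max\{0,\psi\}$, and for $\rho>0$ $$[\phi]_\rho:=\phi+\rho\log\big(1+\exp(-\phi/\rho)\big),\qquad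 [\phi]_\rho'=\big(1+\exp(-\phi/\rho)\big)^{-1},$$ all applied pointwise to elements of $V^*$ (componentwise in the case of a piecewise linear finite element space defined by nodal values). For $(\phi,\varphi)\in V^*\times V$, $$M_\rho(\phi,\varphi):=\phi-[\phi+c\varphi]_\rho,\qquad M(\phi,\varphi):=\phi-[\phi+c\varphi]_+ .$$ The limits for $\rho\downarrow0$ are taken to be $$\lim_{\rho\downarrow0}[\phi]_\rho=[\phi]_+,\qquad \lim_{\rho\downarrow0}[\phi]_\rho'=\mathds{1}_{\phi>0},$$ where $\mathds{1}_{\phi>0}$ equals $1$ where $\phi>0$ and $0$ elsewhere (including where $\phi=0$); thus $M_\rho$ becomes $M$. Penalty Method. (i) Set $k=0$ and initialize $u^0\in V$. (ii) Compute $\alpha_\rho^k=[f-Au^k+c(u^k-g)]_\rho'$, regarded as a diagonal (pointwise multiplication) operator. (iii) Solve $\big((I-\alpha_\rho^k)A+\alpha_\rho^k c\big)\delta u=M_\rho(f-Au^k,u^k-g)$ for $\delta u\in V$, where $I$ is the identity, and set $u^{k+1}=u^k+\delta u$. (iv) Stop if converged, else increment $k$ and return to (ii). Active Set Method. (i) Set $k=0$ and initialize $u^0\in V$. (ii) Compute the active set $\mathcal{A}^k:=\{x\in\Omega:\lambda^k(x)+c(u^k(x)-g(x))>0\}$ with $\lambda^k=f-Au^k$ (for a piecewise linear finite element space with nodes $x_i$: $\mathcal{A}^k:=\{i:\lambda^k(x_i)+c(u^k(x_i)-g(x_i))>0\}$), and let the inactive set $\mathcal{I}^k$ be its complement. (iii)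 Solve $(\mathds{1}_{\mathcal I}^k A+\mathds{1}_{\mathcal A}^k c)u^{k+1}=\mathds{1}_{\mathcal I}^k f+\mathds{1}_{\mathcal A}^k c\,g$ for $u^{k+1}\in V$. (iv) Stop if converged, else increment $k$ and return to (ii). Here $\mathds{1}_{\mathcal A}^k$ is the indicator function, acting as a diagonal (pointwise multiplication) operator, which is the identity on $\mathcal{A}^k$ and zero otherwise; $\mathds{1}_{\mathcal I}^k$ is defined analogously for $\mathcal{I}^k$. *)

(* Defs.v *)
From HB Require Import structures.
From mathcomp Require Import all_boot all_order all_algebra.
From mathcomp Require Import ring.
From mathcomp Require Import all_classical all_reals all_analysis.
Set Implicit Arguments.
Unset Strict Implicit.
Unset Printing Implicit Defensive.
Import Order.TTheory GRing.Theory Num.Theory.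
Import numFieldNormedType.Exports.
Local Open Scope classical_set_scope.
Local Open Scope ring_scope.

Section Dual.
Variables (R : realType) (V : normedModType R).

Definition continuous_functional : {pred V -> R^o} :=
  fun phi => `[< linear phi /\ continuous phi >].

Fact continuous_functional_submod : submod_closed continuous_functional.
Proof.
split; first by apply/asboolP; split=> [a u v|]; [rewrite scaler0 addr0|exact: cst_continuous].
move=> a phi psi /asboolP[lphi cphi] /asboolP[lpsi cpsi]; apply/asboolP; split.
  move=> b u v; rewrite ![(a *: phi + psi) _]/(a * phi _ + psi _) lphi lpsi.
  have E (x y z t : R) :
    a * (b * x + y) + (b * z + t) = b * (a * x + z) + (a * y + t) by ring.
  exact: E.
move=> x; apply: continuousD; last exact: cpsi.
by apply: continuousM; [exact: cst_continuous|exact: cphi].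
Qed.

HB.instance Definition _ :=
  GRing.isSubmodClosed.Build R (V -> R^o) continuous_functional
    continuous_functional_submod.

Definition dual := {phi : V -> R^o | phi \in continuous_functional}.
HB.instance Definition _ := SubChoice.on dual.
HB.instance Definition _ := [SubChoice_isSubLmodule of dual by <:].

Definition pairing (phi : dual) (v : V) : R := val phi v.

Definition dual_norm (phi : dual) : R :=
  sup [set `|pairing phi v| | v in [set v : V | `|v| <= 1]].

Definition reflexive_space : Prop :=
  forall Phi : {linear dual -> R^o},
    (exists C : R, forall phi, `|Phi phi| <= C * dual_norm phi) ->
    exists v : V, forall phi, Phi phi = pairing phi v.

(* A Riesz map exists only if an inner product induces the norm of V. *)
Definition scaled_inverse_Riesz (c : {linear V -> dual}) : Prop :=
  exists (gamma : R) (ip : V -> V -> R),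
    [/\ 0 < gamma,
        forall u v, ip u v = ip v u,
        forall a u v w, ip (a *: u + v) w = a * ip u w + ip v w,
        forall v, ip v v = `|v| ^+ 2
      & forall u v, pairing (c u) v = gamma * ip u v].

Definition bounded_operator (A : {linear V -> dual}) : Prop :=
  exists2 C : R, 0 < C & forall u v, pairing (A u) v <= C * `|u| * `|v|.

Definition elliptic (A : {linear V -> dual}) : Prop :=
  exists2 C : R, 0 < C & forall v, C * `|v| ^+ 2 <= pairing (A v) v.

End Dual.

Section Pointwise.
Variables (R : realType) (n : nat).
Local Notation E := 'rV[R]_n.

(* Identities between functions are understood up to a filter F of "full" sets:
   F = globally X for identities at all points of X (X = Omega, or X = the nodes
   of a finite element space), F = the co-null subsets for identities a.e. *)
Definition near_eq (F : set_system E) (h1 h2 : E -> R) : Prop :=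
  \forall x \near F, h1 x = h2 x.

(* W is a space of functions modulo near_eq F, each given by a representative;
   only the values of representatives on a set in F matter. *)
Record realization (F : set_system E) (W : lmodType R) := Realization {
  repr_fun :> W -> E -> R;
  repr_fun_linear : forall (a : R) (v w : W),
    near_eq F (repr_fun (a *: v + w)) (fun x => a * repr_fun v x + repr_fun w x);
  repr_fun_inj : forall v w : W,
    near_eq F (repr_fun v) (repr_fun w) -> v = w
}.

End Pointwise.

Section Scalar.
Variable R : realType.

Definition softplus (rho t : R) : R := t + rho * ln (1 + expR (- t / rho)).
Definition dsoftplus (rho t : R) : R := (1 + expR (- t / rho))^-1.

(* The limits of softplus and dsoftplus for rho -> 0+; for the latter the value
   at 0 is fixed by convention, since dsoftplus rho 0 = 1/2 for all rho. *)
Definition pos_part (t : R) : R := Num.max 0 t.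
Definition heaviside (t : R) : R := \1_[set s : R | 0 < s] t.

End Scalar.

Section Methods.
Variables (R : realType) (n : nat).
Local Notation E := 'rV[R]_n.
Variables (X : set E) (F : set_system E) (V : normedModType R).
Variable ev : realization F (dual V).
Variables (A c : {linear V -> dual V}) (f : dual V) (g : V).

(* phi - [phi + c w], where [.] is the pointwise application of s. *)
Definition residual (s : R -> R) (phi : dual V) (w : V) : E -> R :=
  fun x => ev phi x - s (ev (phi + c w) x).

(* One iteration of the penalty method, with s and ds in place of the functions
   [.]_rho and [.]_rho'. *)
Definition penalty_scheme_step (s ds : R -> R) (u u' : V) : Prop :=
  let alpha x := ds (ev (f - A u + c (u - g)) x) in
  exists du : V,
    near_eq F (fun x => (1 - alpha x) * ev (A du) x + alpha x * ev (c du) x)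
              (residual s (f - A u) (u - g))
    /\ u' = u + du.

Definition penalty_step (rho : R) : V -> V -> Prop :=
  penalty_scheme_step (softplus rho) (dsoftplus rho).

Definition limit_penalty_step : V -> V -> Prop :=
  penalty_scheme_step (@pos_part R) (@heaviside R).

Definition active_set (u : V) : set E :=
  [set x | X x /\ 0 < ev (f - A u) x + ev (c (u - g)) x].

Definition inactive_set (u : V) : set E := X `\` active_set u.

Definition active_set_step (u u' : V) : Prop :=
  let oneA : E -> R := \1_(active_set u) in
  let oneI : E -> R := \1_(inactive_set u) in
  near_eq F (fun x => oneI x * ev (A u') x + oneA x * ev (c u') x)
            (fun x => oneI x * ev f x + oneA x * ev (c g) x).

End Methods.

(* Main.v *)
Require Import Defs.
From HB Require Import structures.
From mathcomp Require Import all_boot all_order all_algebra.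
From mathcomp Require Import all_classical all_reals all_analysis.
From mathcomp Require Import lra.
Import Order.TTheory GRing.Theory Num.Theory.
Import numFieldNormedType.Exports.
Local Open Scope classical_set_scope.
Local Open Scope ring_scope.

(** At a point of [X] where [f - A u + c (u - g)] is positive, the factor
    [heaviside] equals 1 and the positive part is the identity, so the equation
    for the increment [du] reads [c du = - c (u - g)], that is [c u' = c g] for
    [u' = u + du]. At any other point of [X] both vanish, and the equation reads
    [A du = f - A u], that is [A u' = f]. These are the two cases of the active
    set equation, whose indicators select the same points. Thus the two
    equations agree point by point ([penalty_iff_active_set_at_point]).

    The elements of the dual are represented by functions only up to the filter
    [F], so representatives are additive only on a set of [F]. Each equation
    involves finitely many sums; on the intersection of the corresponding sets
    with [X] the pointwise argument applies, and [near_eq_congr] carries it to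
    identities modulo [F]. *)

Lemma near_eq_congr {R : realType} {n : nat} {F : set_system 'rV[R]_n}
    {F_filter : Filter F} {h1 h2 k1 k2 : 'rV[R]_n -> R} :
  (\forall x \near F, h1 x = h2 x <-> k1 x = k2 x) ->
  near_eq F h1 h2 <-> near_eq F k1 k2.
Proof.
by move=> hk; split; apply: filterS2 hk => x [hk kh]; [exact: hk|exact: kh].
Qed.

Lemma repr_funD {R : realType} {n : nat} {F : set_system 'rV[R]_n}
    (F_filter : Filter F) {W : lmodType R} (ev : realization F W) (v w : W) :
  near_eq F (ev (v + w)) (fun x => ev v x + ev w x).
Proof.
have := repr_fun_linear ev 1 v w; rewrite scale1r.
by apply: filterS => x ->; rewrite mul1r.
Qed.

Lemma repr_funB {R : realType} {n : nat} {F : set_system 'rV[R]_n}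
    (F_filter : Filter F) {W : lmodType R} (ev : realization F W) (v w : W) :
  near_eq F (ev (v - w)) (fun x => ev v x - ev w x).
Proof.
have := repr_fun_linear ev (-1) w v; rewrite scaleN1r [- w + v]addrC.
by apply: filterS => x ->; rewrite mulN1r addrC.
Qed.

(** The variables are the values at one point; primes mark the new iterate. For
    [0 < d] the term [fx - Au] cancels against [pos_part d], and [cu] cancels
    from what is left; otherwise [Au] cancels from both sides. *)
Lemma penalty_iff_active_set_at_point (R : realType) (fx Au Au' cu cu' cg : R) :
  let d := fx - Au + (cu - cg) in
  (1 - heaviside d) * (Au' - Au) + heaviside d * (cu' - cu)
    = fx - Au - pos_part d
  <-> (~~ (0 < d)%R)%:R * Au' + (0 < d)%R%:R * cu'
    = (~~ (0 < d)%R)%:R * fx + (0 < d)%R%:R * cg.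
Proof.
move=> d.
have -> : heaviside d = (0 < d)%R%:R.
  by rewrite /heaviside indicE; congr (_%:R); rewrite mem_setE.
rewrite /pos_part /Num.max.
by case: ltP => _ /=; rewrite /d; split=> eq_d; lra.
Qed.

Theorem lemma2 (R : realType) (n : nat) (Omega : set 'rV[R]_n)
  (Omega_open : open Omega)
  (X : set 'rV[R]_n)
  (X_points : X = Omega \/ (finite_set X /\ X `<=` closure Omega))
  (F : set_system 'rV[R]_n) (F_filter : Filter F) (F_X : F X)
  (V : completeNormedModType R)
  (V_reflexive : reflexive_space V)
  (evV : realization F V)
  (ev : realization F (dual V))
  (A : {linear V -> dual V})
  (A_bounded : bounded_operator A) (A_elliptic : elliptic A)
  (c : {linear V -> dual V}) (c_Riesz : scaled_inverse_Riesz c)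
  (f : dual V) (g : V)
  (u : nat -> V) (k : nat) :
  limit_penalty_step ev A c f g (u k) (u k.+1) <->
  active_set_step X ev A c f g (u k) (u k.+1).
Proof.
(* The increment is determined by the two iterates: du = u' - u. *)
have step_eq : limit_penalty_step ev A c f g (u k) (u k.+1) <->
    near_eq F
      (fun x => let al := heaviside (ev (f - A (u k) + c (u k - g)) x) in
        (1 - al) * ev (A (u k.+1 - u k)) x + al * ev (c (u k.+1 - u k)) x)
      (residual ev c (@pos_part R) (f - A (u k)) (u k - g)).
  split=> [[du [eq_du ->]]|eq_du]; first by rewrite [u k + du]addrC addrK.
  by exists (u k.+1 - u k); split=> //; rewrite addrC subrK.
apply: (iff_trans step_eq); apply: near_eq_congr.
have ev_d := repr_funD F_filter ev (f - A (u k)) (c (u k - g)).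
have ev_lambda := repr_funB F_filter ev f (A (u k)).
have ev_cw := repr_funB F_filter ev (c (u k)) (c g).
have ev_Adu := repr_funB F_filter ev (A (u k.+1)) (A (u k)).
have ev_cdu := repr_funB F_filter ev (c (u k.+1)) (c (u k)).
move: ev_cw ev_Adu ev_cdu; rewrite -!linearB => ev_cw ev_Adu ev_cdu.
apply: filterS2 (filterI F_X (filterI ev_d ev_lambda))
  (filterI ev_cw (filterI ev_Adu ev_cdu)).
move=> x [Xx [dE lambdaE]] [cwE [AduE cduE]].
have activeE : (x \in active_set X ev A c f g (u k)) =
    (0 < ev f x - ev (A (u k)) x + (ev (c (u k)) x - ev (c g) x)).
  rewrite -lambdaE -cwE; apply/idP/idP; first by rewrite inE => -[].
  by move=> d_gt0; rewrite inE; split.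
have inactiveE : (x \in inactive_set X ev A c f g (u k)) =
    ~~ (x \in active_set X ev A c f g (u k)).
  by rewrite /inactive_set in_setD (mem_set Xx).
rewrite /residual dE AduE cduE lambdaE cwE !indicE inactiveE activeE.
exact: penalty_iff_active_set_at_point.
Qed.
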